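(* If $\alpha\eqsim1$ and $\beta\eqsim\lambda^{-1}$, then $$|\!|\!|(y,p)|\!|\!|_\lambda^2\eqsim G(y,p;0,0)\qquad\text{for all }(y,p)\in Y\times Y^\star.$$
   Context: All Hilbert spaces are real; $(\cdot,\cdot)_V$ and $\|\cdot\|_V$ denote the inner product and norm of a Hilbert space $V$. Let $H,X,Y,Y^\star$ be Hilbert spaces ($Y^\star$ is simply another Hilbert space, not necessarily the dual of $Y$), let $X_{\mathrm{ad}}\subseteq X$ be a closed subspace (unconstrained case), and let $Z=\boldsymbol{L}^2(\Omega_1)\times\cdots\times\boldsymbol{L}^2(\Omega_n)$, where $\Omega_1,\dots,\Omega_n$ are Lipschitz domains and each $\boldsymbol{L}^2(\Omega_j)$ is a Lebesgue space of square-integrable scalar- or vector-valued functions. Let $\mathcal{A}\colon Z\to H$, $\mathcal{B}\colon X\to Z$, $\mathcal{C}\colon X\to X$ be bounded linear operators with (Hilbert space) adjoints $\mathcal{A}^*\colon H\to Z$, $\mathcal{B}^*\colon Z\to X$, where $\mathcal{C}=\mathcal{C}^*$ and there is $\kappa>0$ with $(\mathcal{C}u,u)_X\ge\kappa\|u\|_X^2$ for all $u\in X$. Let $\mathcal{L}\colon Y\to Z$ and $\mathcal{L}^\star\colon Y^\star\to Z$ be bounded linear bijections, and let $\mathcal{I}\colon Y\to Z$, $\mathcal{I}^\star\colon Y^\star\to Z$ be bounded linear operators with $(\mathcal{L}y,\mathcal{I}^\star p)_Z=(\mathcal{I}y,\mathcal{L}^\star p)_Z$ for all $y\in Y$, $p\in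 Y^\star$. The cost parameter satisfies $0<\lambda\le1$. $\Pi_{X_{\mathrm{ad}}}$ denotes the orthogonal projection of $X$ onto $X_{\mathrm{ad}}$ with respect to the inner product $(u,v)_{\mathcal{C}}:=(\mathcal{C}u,v)_X$. For $\alpha,\beta>0$, $f\in Z$, $z_d\in H$ the least-squares functional is $$G(y,p;f,z_d)=\alpha\|\mathcal{L}y+\mathcal{B}\Pi_{X_{\mathrm{ad}}}\lambda^{-1}\mathcal{C}^{-1}\mathcal{B}^*\mathcal{I}^\star p-f\|_Z^2+\beta\|\mathcal{L}^\star p-\mathcal{A}^*(\mathcal{A}\mathcal{I}y-z_d)\|_Z^2.$$ For $u\in X$, $y\in Y$ let $y_u\in Y$ and $p_y\in Y^\star$ be the unique solutions of $\mathcal{L}y_u=-\mathcal{B}u$ and $\mathcal{L}^\star p_y=\mathcal{A}^*\mathcal{A}\mathcal{I}y$. Define $$|\!|\!|(u,y,p)|\!|\!|_\lambda^2=\lambda\|u\|_X^2+\|y-y_u\|_Y^2+\lambda^{-1}\|p-p_y\|_{Y^\star}^2+\|\mathcal{A}\mathcal{I}y_u\|_H^2$$ for $(u,y,p)\in X\times Y\times Y^\star$, and $$|\!|\!|(y,p)|\!|\!|_\lambda:=|\!|\!|(\Pi_{X_{\mathrm{ad}}}\lambda^{-1}\mathcal{C}^{-1}\mathcal{B}^*\mathcal{I}^\star p,\,y,\,p)|\!|\!|_\lambda\quad\text{for }(y,p)\in Y\times Y^\star.$$ $A\lesssim B$ means $A\le C\,B$ with a constant $C>0$ independent of $\lambda\in(0,1]$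 and of the elements $y,p$ (the spaces and operators being fixed; $C$ may depend on the constants in $\alpha\eqsim1$, $\beta\eqsim\lambda^{-1}$); $A\eqsim B$ means $A\lesssim B\lesssim A$. *)

(* Defs.v *)
From HB Require Import structures.
From mathcomp Require Import all_boot all_order all_algebra.
From mathcomp Require Import all_classical all_reals all_analysis.
Set Implicit Arguments.
Unset Strict Implicit.
Unset Printing Implicit Defensive.
Import Order.TTheory GRing.Theory Num.Theory.
Import numFieldNormedType.Exports.
Local Open Scope classical_set_scope.
Local Open Scope ring_scope.

HB.mixin Record CompleteNormedModule_isHilbert (R : realType) V
    of CompleteNormedModule R V := {
  inner : V -> V -> R ;
  innerC : forall u v, inner u v = inner v u ;
  inner_linearl : forall (a : R) u v w,
    inner (a *: u + v) w = a * inner u w + inner v w ;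
  inner_norm : forall u, inner u u = `|u| ^+ 2
}.

#[short(type="hilbertType")]
HB.structure Definition Hilbert (R : realType) :=
  {V of CompleteNormedModule R V & CompleteNormedModule_isHilbert R V}.

Section Operators.
Context {R : realType}.

Definition bounded_operator (V W : hilbertType R) (f : V -> W) :=
  exists M : R, forall v, `|f v| <= M * `|v|.

(* [get] chooses a preimage; it is the inverse when [f] is bijective. *)
Definition op_inv (V W : hilbertType R) (f : V -> W) (w : W) : V :=
  get [set v | f v = w].

(* The vector chosen is unique, and exists (Riesz) when [f] is linear and
   bounded. *)
Definition adjoint (V W : hilbertType R) (f : V -> W) (w : W) : V :=
  get [set v | forall v', inner (f v') w = inner v' v].

Definition linear_subspace (V : hilbertType R) (S : set V) :=
  S 0 /\ forall (a : R) u v, S u -> S v -> S (a *: u + v).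

(* Orthogonal projection onto the subspace [S] with respect to the inner
   product (u, v) |-> (C u, v); the vector chosen is unique, and exists when
   [S] is closed and [C] is bounded, self-adjoint and coercive. *)
Definition proj_wrt (V : hilbertType R) (C : V -> V) (S : set V) (u : V) : V :=
  get [set w | S w /\ forall v, S v -> inner (C (u - w)) v = 0].

End Operators.

Section LebesgueTuple.
Context {R : realType}.

Definition cons_pair d (x : R * d.-tuple R) : d.+1.-tuple R :=
  [tuple of x.1 :: x.2].

Lemma measurable_cons_pair d :
  measurable_fun [set: R * d.-tuple R] (@cons_pair d).
Proof. exact: measurable_cons. Qed.

Section succ.
Variables (d : nat) (mu : {sigma_finite_measure set (d.-tuple R) -> \bar R}).

Definition lebesgue_succ : set (d.+1.-tuple R) -> \bar R :=
  pushforward (@lebesgue_measure R \x mu)%E (@cons_pair d).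

HB.instance Definition _ := Measure.copy lebesgue_succ
  (measure_function_pushforward__canonical__measure_function_Measure
     (@lebesgue_measure R \x mu)%E (@measurable_cons_pair d)).

Let lebesgue_succ_sigma_finite : sigma_finite setT lebesgue_succ.
Proof.
have /sigma_finiteP[F [TF ndF Foo]] := sigma_finiteT (@lebesgue_measure R).
have /sigma_finiteP[G [TG ndG Goo]] := sigma_finiteT mu.
pose split (t : d.+1.-tuple R) : R * d.-tuple R :=
  (tnth t ord0, [tuple of behead t]).
have splitK : cancel (@cons_pair d) split.
  by move=> [x t]; congr pair; exact/val_inj.
exists (fun k => split @^-1` (F k `*` G k)).
  apply/esym; rewrite -subTset => t _.
  have [n _ Fn] : (\bigcup_k F k) (split t).1 by rewrite -TF.
  have [k _ Gk] : (\bigcup_k G k) (split t).2 by rewrite -TG.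
  exists (maxn n k) => //; split.
    by move: Fn; exact/subsetPset/ndF/leq_maxl.
  by move: Gk; exact/subsetPset/ndG/leq_maxr.
move=> k; have [mF Fk] := Foo k; have [mG Gk] := Goo k; split.
  rewrite (_ : _ @^-1` _ = (fun t : d.+1.-tuple R => tnth t ord0) @^-1` F k `&`
    (fun t : d.+1.-tuple R => [tuple of behead t]) @^-1` G k)//.
  apply: measurableI.
    by rewrite -[X in measurable X]setTI; exact: measurable_tnth.
  by rewrite -[X in measurable X]setTI; exact: measurable_behead.
rewrite /lebesgue_succ /pushforward (_ : _ @^-1` _ = F k `*` G k); last first.
  by apply/funext => x; rewrite -[in RHS](splitK x).
by rewrite product_measure1E// lte_mul_pinfty// ge0_fin_numE.
Qed.

HB.instance Definition _ := Measure_isSigmaFinite.Build _ _ _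
  lebesgue_succ lebesgue_succ_sigma_finite.

End succ.

(* Lebesgue measure on the Borel sets of R^d, as an iterated product. *)
Fixpoint lebesgue_tuple (d : nat) :
    {sigma_finite_measure set (d.-tuple R) -> \bar R} :=
  match d with
  | 0 => \d_[tuple]
  | d'.+1 => lebesgue_succ (lebesgue_tuple d')
  end.

End LebesgueTuple.

Section LipschitzDomain.
Context {R : realType}.

(* Near each boundary point, and after an orthogonal change of coordinates, the
   domain is the strict epigraph of a Lipschitz function of the first [d]
   coordinates. Boundedness is not required. *)
Definition lipschitz_domain d (Omega : set 'rV[R]_d.+1) :=
  [/\ Omega !=set0, open Omega, connected Omega &
    forall x, closure Omega x -> ~ Omega x ->
      exists (O : 'M[R]_d.+1) (gamma : 'rV[R]_d -> R^o),
        [/\ O *m O^T = 1%:M, lipschitz gamma &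
          \forall z \near x,
            Omega z <-> gamma (col' ord_max (z *m O)) < (z *m O) 0 ord_max]].

End LipschitzDomain.

Section L2Product.
Context {R : realType} (n : nat) (d m : 'I_n -> nat)
  (Omega : forall j : 'I_n, set 'rV[R]_(d j).+1).

Definition domain_tuple (j : 'I_n) : set ((d j).+1.-tuple R) :=
  [set t | @Omega j (\row_i tnth t i)].
Arguments domain_tuple j : clear implicits.

(* [f j k] is the [k]-th component of the R^(m j + 1)-valued function on
   [Omega j]. *)
Definition function_family :=
  forall j : 'I_n, 'I_(m j).+1 -> (d j).+1.-tuple R -> R.

Definition square_integrable (f : function_family) :=
  forall j k, measurable_fun (domain_tuple j) (f j k) /\
    (lebesgue_tuple (d j).+1).-integrable (domain_tuple j)
      (EFin \o (fun x => f j k x ^+ 2)).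

(* [Z] is the product over j of the spaces L^2(Omega j; R^(m j + 1)): its
   elements are the classes of square-integrable families, added and scaled
   pointwise, with the L^2 inner product. Families equal almost everywhere are
   identified, since their difference has norm 0. *)
Definition is_L2_product (Z : hilbertType R) :=
  exists cls : function_family -> Z,
    [/\ forall z, exists2 f, square_integrable f & cls f = z,
        forall (a : R) f g, square_integrable f -> square_integrable g ->
          cls (fun j k x => a * f j k x + g j k x) = a *: cls f + cls g &
        forall f g, square_integrable f -> square_integrable g ->
          inner (cls f) (cls g) =
            \sum_(j < n) \sum_(k < (m j).+1)
              \int[lebesgue_tuple (d j).+1]_(x in domain_tuple j)
                (f j k x * g j k x)].

End L2Product.
Arguments domain_tuple {R n d} Omega j.

Section LeastSquares.
Context {R : realType} (H X Y Ystar Z : hilbertType R).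
Variables (Xad : set X) (A : Z -> H) (B : X -> Z) (C : X -> X).
Variables (L : Y -> Z) (Lstar : Ystar -> Z) (I : Y -> Z) (Istar : Ystar -> Z).

Definition control (lambda : R) (p : Ystar) : X :=
  proj_wrt C Xad (lambda^-1 *: op_inv C (adjoint B (Istar p))).

Definition ls_functional (alpha beta lambda : R) (y : Y) (p : Ystar)
    (f : Z) (zd : H) : R :=
  alpha * `|L y + B (control lambda p) - f| ^+ 2 +
  beta * `|Lstar p - adjoint A (A (I y) - zd)| ^+ 2.

Definition state_of (u : X) : Y := op_inv L (- B u).

Definition adjoint_state_of (y : Y) : Ystar :=
  op_inv Lstar (adjoint A (A (I y))).

(* Square of the triple norm on X x Y x Ystar. *)
Definition energy_sq (lambda : R) (u : X) (y : Y) (p : Ystar) : R :=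
  lambda * `|u| ^+ 2 + `|y - state_of u| ^+ 2
  + lambda^-1 * `|p - adjoint_state_of y| ^+ 2
  + `|A (I (state_of u))| ^+ 2.

(* Square of the triple norm on Y x Ystar. *)
Definition reduced_energy_sq (lambda : R) (y : Y) (p : Ystar) : R :=
  energy_sq lambda (control lambda p) y p.

End LeastSquares.

(* Main.v *)
Require Import Defs.
From mathcomp Require Import all_boot all_order all_algebra.
From mathcomp Require Import all_classical all_reals all_analysis.
From mathcomp Require Import ring lra.
Import Order.TTheory GRing.Theory Num.Theory.
Import numFieldNormedType.Exports.
Local Open Scope classical_set_scope.
Local Open Scope ring_scope.

(** The upper bound of the functional by the energy is immediate.  Since
    [L y_u = - B u] and [Lstar p_y = A^* A I y], the two residuals are
    [L y + B u = L (y - y_u)] and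
    [Lstar p - A^* A I y = Lstar (p - p_y)] ([ls_functional_homogeneous]), and
    [L], [Lstar] are bounded.

    For the converse, [L] and [Lstar] have bounded inverses
    ([bounded_inverse]), so the functional controls [|y - y_u|^2] and
    [lambda^-1 |p - p_y|^2].  It remains to bound the other two terms of the
    energy by these two ([control_energy_le]).  The control [u] lies in [Xad]
    and solves [lambda (C u, v) = (Istar p, B v)] for all [v] in [Xad]
    ([controlP]).  Take [v = u] and split [p] as [(p - p_y) + p_y].  The
    relation [(L y, Istar p) = (I y, Lstar p)] turns the contribution of [p_y]
    into [- (A I y_u, A I y)], which gives the identity
    [optimality_identity]:
      lambda (C u, u) + |A I y_u|^2
        = (Istar (p - p_y), B u) - (A I y_u, A I (y - y_u)).
    The left-hand side is bounded below by coercivity of [C]; on the right,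
    Young's inequality, with the weight [lambda] distributed as in the energy
    norm, absorbs [u] and [A I y_u] into the left-hand side.  All constants are
    independent of [lambda].

    The functional analysis behind this rests on one existence result,
    [variational_solution]: on a closed subspace a symmetric bounded coercive
    form represents every bounded functional.  It is proved by minimising the
    associated quadratic energy.  Applied to the identity it is the Riesz
    theorem, hence gives adjoints; applied to [C] it gives the inverse of [C]
    and the projection onto [Xad].  Applied to [f f^*] it gives the bounded
    inverse theorem: the uniform boundedness principle shows that the adjoint
    of a bounded bijection [f] is bounded below, so [f f^*] is coercive. *)

(** * Real inner products *)

Section InnerProduct.
Context {R : realType} {V : hilbertType R}.
Implicit Types (u v w : V) (a : R).

Lemma innerDl u v w : inner (u + v) w = inner u w + inner v w.
Proof. by rewrite -[u]scale1r inner_linearl mul1r scale1r. Qed.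

Lemma inner0l w : inner 0 w = 0.
Proof. by apply: (@addrI _ (inner 0 w)); rewrite -innerDl !addr0. Qed.

Lemma innerZl a u w : inner (a *: u) w = a * inner u w.
Proof. by rewrite -[a *: u]addr0 inner_linearl inner0l addr0. Qed.

Lemma innerNl u w : inner (- u) w = - inner u w.
Proof. by rewrite -scaleN1r innerZl mulN1r. Qed.

Lemma innerBl u v w : inner (u - v) w = inner u w - inner v w.
Proof. by rewrite innerDl innerNl. Qed.

Lemma innerDr w u v : inner w (u + v) = inner w u + inner w v.
Proof. by rewrite innerC innerDl !(innerC w). Qed.

Lemma innerZr a w u : inner w (a *: u) = a * inner w u.
Proof. by rewrite innerC innerZl innerC. Qed.

Lemma innerNr w u : inner w (- u) = - inner w u.
Proof. by rewrite innerC innerNl innerC. Qed.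

Lemma innerBr w u v : inner w (u - v) = inner w u - inner w v.
Proof. by rewrite innerDr innerNr. Qed.

Lemma inner_inj u v : (forall w, inner u w = inner v w) -> u = v.
Proof.
move=> uv; apply/eqP; rewrite -subr_eq0 -normr_eq0 -sqrf_eq0 -inner_norm.
by rewrite innerBl uv subrr.
Qed.

End InnerProduct.

(** A nonnegative quadratic polynomial has nonpositive (reduced) discriminant;
    the degenerate case [a = 0] is included. *)
Lemma discriminant_le {R : realFieldType} (a b c : R) : 0 <= a ->
  (forall t, 0 <= a * t ^+ 2 + 2 * b * t + c) -> b ^+ 2 <= a * c.
Proof.
rewrite le_eqVlt => /predU1P[<-|a0] H.
  have [->|b0] := eqVneq b 0; first by rewrite expr0n /= mul0r.
  (* a nonconstant affine function takes the value -1 *)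
  have := H (- (c + 1) / (2 * b)).
  rewrite mul0r add0r mulrC divfK ?mulf_neq0 ?pnatr_eq0//; lra.
have := H (- b / a).
rewrite (_ : _ + c = (a * c - b ^+ 2) / a); last by field; exact: lt0r_neq0.
by rewrite pmulr_lge0 ?invr_gt0// subr_ge0.
Qed.

Lemma cauchy_schwarz {R : realType} {V : hilbertType R} (u v : V) :
  `|inner u v| <= `|u| * `|v|.
Proof.
rewrite -ler_sqr ?nnegrE ?mulr_ge0// real_normK ?num_real// exprMn.
apply: discriminant_le => [|t]; first exact: sqr_ge0.
have := sqr_ge0 `|t *: u + v|; rewrite -inner_norm => /le_trans; apply.
rewrite innerDl !innerDr !innerZl !innerZr !inner_norm (innerC v u).
by rewrite le_eqVlt; apply/orP; left; apply/eqP; ring.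
Qed.

(** The bound of a bounded operator may be taken positive. *)
Lemma bounded_operator_gt0 {R : realType} {V W : hilbertType R} (f : V -> W) :
  bounded_operator f -> exists2 M : R, 0 < M & forall v, `|f v| <= M * `|v|.
Proof.
move=> [M fM]; exists (`|M| + 1) => [|v]; first by rewrite ltr_wpDl.
apply: (le_trans (fM v)); rewrite ler_wpM2r// (le_trans (ler_norm M))//.
by rewrite lerDl.
Qed.

(** * Minimisation of coercive quadratic energies *)

Section Variational.
Context {R : realType} {V : hilbertType R}.
Variables (S : set V) (C : V -> V) (M kappa : R) (phi : V -> R) (F : R).
Hypotheses (S_sub : linear_subspace S) (S_closed : closed S).
Hypotheses (M_gt0 : 0 < M) (C_bounded : forall v, `|C v| <= M * `|v|).
Hypothesis C_sym : forall u v, inner (C u) v = inner u (C v).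
Hypotheses (kappa_gt0 : 0 < kappa)
  (C_coercive : forall u, kappa * `|u| ^+ 2 <= inner (C u) u).
Hypothesis phi_linear : forall a u v, phi (a *: u + v) = a * phi u + phi v.
Hypothesis phi_bounded : forall v, `|phi v| <= F * `|v|.

(** The symmetric bilinear form of [C]. *)
Let form (u v : V) := inner (C u) v.

Let form_line (a : R) u v w : form (a *: u + v) w = a * form u w + form v w.
Proof. by rewrite /form C_sym innerDl innerZl -!C_sym. Qed.

Let formBl u v w : form (u - v) w = form u w - form v w.
Proof. by rewrite /form C_sym innerBl -!C_sym. Qed.

Let formC u v : form u v = form v u.
Proof. by rewrite /form C_sym innerC. Qed.

Let form_ge0 u : 0 <= form u u.
Proof. by rewrite (le_trans _ (C_coercive u))// mulr_ge0 ?sqr_ge0// ltW. Qed.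

(** The quadratic energy, whose Euler equation on [S] is
    [form w v = phi v] for all [v] in [S]. *)
Let energy u := 2^-1 * form u u - phi u.

Let energy_line (t : R) u v : energy (t *: v + u) =
  2^-1 * form v v * t ^+ 2 + 2 * (2^-1 * (form u v - phi v)) * t + energy u.
Proof.
rewrite /energy phi_linear form_line formC form_line (formC u (_ + _)).
by rewrite form_line (formC v u); field.
Qed.

Let energy_bounded_below u : - (F ^+ 2 / (2 * kappa)) <= energy u.
Proof.
have phiu : phi u <= F * `|u| := le_trans (ler_norm _) (phi_bounded u).
have : 0 <= (kappa * `|u| - F) ^+ 2 / (2 * kappa).
  by rewrite divr_ge0 ?sqr_ge0// mulr_ge0// ltW.
rewrite (_ : _ / _ = 2^-1 * (kappa * `|u| ^+ 2) - F * `|u|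
  + F ^+ 2 / (2 * kappa)); last by field; exact: lt0r_neq0.
have := C_coercive u; rewrite /energy /form; lra.
Qed.

(** A near-minimiser nearly solves the Euler equation: the energy along the
    line through [u] in direction [v] cannot drop by more than [e]. *)
Let euler_defect (m e : R) u v : (forall w, S w -> m <= energy w) ->
  S u -> S v -> energy u <= m + e ->
  (form u v - phi v) ^+ 2 <= 2 * e * form v v.
Proof.
move=> m_lb Su Sv ume.
have vv := form_ge0 v.
have /discriminant_le : forall t, 0 <= 2^-1 * form v v * t ^+ 2 +
    2 * (2^-1 * (form u v - phi v)) * t + e.
  move=> t; have := m_lb _ (S_sub.2 t _ _ Sv Su).
  rewrite energy_line; lra.
by rewrite mulr_ge0// => /(_ isT); rewrite exprMn; lra.
Qed.

(** Riesz representation with respect to a symmetric coercive form on a closed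
    subspace. Linearity of [C] follows from its symmetry. *)
Lemma variational_solution :
  exists2 w, S w & forall v, S v -> inner (C w) v = phi v.
Proof.
pose E := energy @` S.
have E0 : E !=set0 by exists (energy 0); exists 0 => //; exact: S_sub.1.
have hE : has_inf E.
  by split => //; exists (- (F ^+ 2 / (2 * kappa))) => _ [u _ <-].
have m_lb w : S w -> inf E <= energy w.
  by move=> Sw; apply: ge_inf; [exact: hE.2|exists w].
have /choice[u uE] : forall n : nat,
    exists w, S w /\ energy w <= inf E + harmonic n.
  move=> n; have [_ [w Sw <-] we] := inf_adherent (@harmonic_gt0 R n) hE.
  by exists w; split => //; exact: ltW.
have Su n : S (u n) := (uE n).1.
have defect n v : S v ->
    (form (u n) v - phi v) ^+ 2 <= 2 * harmonic n * form v v.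
  by move=> Sv; apply: euler_defect m_lb _ Sv _ => //; exact: (uE n).2.
have SB v w : S v -> S w -> S (v - w).
  by move=> Sv Sw; rewrite addrC -scaleN1r; apply: S_sub.2.
(* a minimising sequence is Cauchy: test the two Euler defects against the
   difference of the two terms *)
have dist i j : kappa * `|u i - u j| ^+ 2 <= 4 * (harmonic i + harmonic j).
  have Sv := SB _ _ (Su i) (Su j); set v := u i - u j in Sv *.
  apply: (le_trans (C_coercive v)); rewrite -/(form v v).
  have di := defect i v Sv; have dj := defect j v Sv.
  have vE : form v v = (form (u i) v - phi v) - (form (u j) v - phi v).
    by rewrite {1}/v formBl; ring.
  set x := form (u i) v - phi v in di vE *.
  set y := form (u j) v - phi v in dj vE *.
  have := form_ge0 v; rewrite le_eqVlt => /predU1P[<-|v0].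
    by rewrite mulr_ge0// addr_ge0// ltW// harmonic_gt0.
  rewrite -(ler_pM2r v0).
  rewrite (le_trans _ (_ : 2 * (x ^+ 2 + y ^+ 2) <= _))//; last lra.
  by rewrite {1 2}vE; have := sqr_ge0 (x + y); lra.
have ucvg : cvgn u.
  apply/cauchy_cvgP/cauchy_exP => e e0.
  have k0 : 0 < kappa * e ^+ 2 / 8 by rewrite divr_gt0// mulr_gt0// exprn_gt0.
  have [N _ HN] : \forall n \near \oo, @harmonic R n < kappa * e ^+ 2 / 8.
    have /cvgrPdist_lt/(_ _ k0) := @cvg_harmonic R.
    apply: filterS => n; rewrite sub0r normrN; exact: le_lt_trans (ler_norm _).
  exists (u N), N => // k Nk; rewrite -ball_normE.
  suff : `|u N - u k| < e by [].
  have := HN N (leqnn N); have := HN k Nk; have := dist N k.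
  set a := harmonic N; set b := harmonic k => d1 d2 d3.
  rewrite -ltr_sqr ?nnegrE// ?ltW// -(ltr_pM2l kappa_gt0); lra.
have [w uw] : exists w : V, u @ \oo --> w by exists (limn u).
exists w => [|v Sv].
  by apply: (closed_cvg _ S_closed) uw; exact: nearW.
(* the Euler defect of the limit is smaller than any e > 0 *)
apply/eqP; rewrite -subr_eq0 -normr_le0; apply/ler_addgt0Pl => e e0.
rewrite addr0 -/(form w v).
have e2 : 0 < e / 2 / (M * `|v| + 1).
  by rewrite !divr_gt0// ltr_wpDl// mulr_ge0// ltW.
have e3 : 0 < (e / 2) ^+ 2 / (2 * form v v + 1).
  by rewrite divr_gt0 ?exprn_gt0 ?divr_gt0// ltr_wpDl// mulr_ge0.
have [n [un hn]] : exists n, `|w - u n| < e / 2 / (M * `|v| + 1) /\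
    @harmonic R n < (e / 2) ^+ 2 / (2 * form v v + 1).
  have /cvgrPdist_lt/(_ _ e2) A1 := uw.
  have /cvgrPdist_lt/(_ _ e3) A2 := @cvg_harmonic R.
  have [N _ HN] := filterI A1 A2.
  exists N; have [? h] := HN N (leqnn N); split => //.
  by move: h; rewrite /= sub0r normrN; exact: le_lt_trans (ler_norm _).
rewrite (_ : form w v - phi v = form (w - u n) v + (form (u n) v - phi v)).
  rewrite (le_trans (ler_normD _ _))// [leRHS](splitr e) lerD//.
    rewrite (le_trans (cauchy_schwarz _ _))//.
    rewrite (le_trans (ler_wpM2r _ (C_bounded _)))//.
    rewrite mulrAC mulrC.
    move/ltW: un; rewrite ler_pdivlMr; last by rewrite ltr_wpDl// mulr_ge0// ltW.
    by apply: le_trans; rewrite ler_wpM2l// lerDl.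
  rewrite -ler_sqr ?nnegrE ?divr_ge0 ?(ltW e0)// real_normK ?num_real//.
  apply: (le_trans (defect n v Sv)).
  move/ltW: hn; rewrite ler_pdivlMr; last by rewrite ltr_wpDl// mulr_ge0.
  apply: le_trans; rewrite mulrAC mulrC ler_wpM2l ?lerDl//.
  exact/ltW/harmonic_gt0.
by rewrite formBl addrA subrK.
Qed.

End Variational.

(** * Adjoints and the bounded inverse theorem *)

Lemma linear_subspaceT {R : realType} {V : hilbertType R} :
  linear_subspace [set: V].
Proof. by []. Qed.

Section Adjoint.
Context {R : realType} {V W : hilbertType R}.
Variable f : {linear V -> W}.
Hypothesis f_bounded : bounded_operator f.

(** Existence of the adjoint, by the Riesz theorem. *)
Lemma adjointP (w : W) (v : V) : inner (f v) w = inner v (adjoint f w).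
Proof.
suff : exists x, forall v', inner (f v') w = inner v' x.
  by move=> /getPex; exact.
have [K K0 fK] := bounded_operator_gt0 _ f_bounded.
have [|||||||u _ uE] := @variational_solution R V [set: V] id 1 1
    (fun v => inner (f v) w) (K * `|w|) linear_subspaceT closedT.
- exact: ltr01.
- by move=> x; rewrite mul1r.
- by [].
- exact: ltr01.
- by move=> x; rewrite mul1r inner_norm.
- by move=> a x y; rewrite linearP innerDl innerZl.
- move=> x; rewrite (le_trans (cauchy_schwarz _ _))// mulrAC ler_wpM2r//.
by exists u => x; rewrite -uE// innerC.
Qed.

Lemma adjoint_bounded : bounded_operator (adjoint f).
Proof.
have [K K0 fK] := bounded_operator_gt0 _ f_bounded.
exists K => w; have [->|z0] := eqVneq (adjoint f w) 0.
  by rewrite normr0 mulr_ge0// ltW.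
rewrite -(@ler_pM2l _ `|adjoint f w|) ?normr_gt0// -expr2 -inner_norm -adjointP.
rewrite (le_trans (ler_norm _))// (le_trans (cauchy_schwarz _ _))//.
by rewrite mulrCA mulrA ler_wpM2r.
Qed.

End Adjoint.

Section BoundedInverse.
Context {R : realType} {V W : hilbertType R}.
Variable f : {linear V -> W}.
Hypotheses (f_bounded : bounded_operator f) (f_bij : bijective f).

(** By the uniform boundedness principle: if [|(f v, w)| <= |v|] for all [v],
    then the functional [(., w)] is bounded at each point [f v] independently
    of [w], so the norms of all such [w] are bounded. *)
Let adjoint_bounded_below :
  exists2 M : R, 0 < M & forall w, `|w| <= M * `|adjoint f w|.
Proof.
pose T : set (W -> R^o) := [set g | exists2 w : W,
  g = (fun z => inner z w) & forall v, `|inner (f v) w| <= `|v|].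
have [||M HM] := @Banach_Steinhauss R W R^o T _ _ 1.
- move=> _ [w -> _]; split => [r|a x y]; last by rewrite innerDl innerZl.
  exists (r * `|w|) => x xr; rewrite (le_trans (cauchy_schwarz _ _))//.
  by rewrite ler_wpM2r.
- move=> z; have [g _ gK] := f_bij; exists `|g z| => _ [w -> wf].
  by rewrite -[X in inner X](gK z); exact: wf.
have {}HM w : (forall v, `|inner (f v) w| <= `|v|) -> `|w| <= M.
  move=> wf; have [->|w0] := eqVneq w 0.
    rewrite normr0; have := HM (fun z : W => inner z 0).
    have T0 : T (fun z => inner z 0).
      by exists 0 => // v; rewrite innerC inner0l normr0.
    by move=> /(_ T0 0); rewrite normr0 ler01 inner0l normr0; exact.
  have := HM (fun z => inner z w) (ex_intro2 _ _ w erefl wf) (`|w|^-1 *: w).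
  rewrite normrZ normfV normr_id mulVf ?normr_eq0// lexx => /(_ isT).
  by rewrite innerZl inner_norm expr2 mulKf ?normr_eq0// normr_id.
exists (`|M| + 1) => [|w]; first by rewrite ltr_wpDl.
have [aw0|aw0] := eqVneq (adjoint f w) 0.
  suff -> : w = 0 by rewrite normr0 mulr_ge0// addr_ge0.
  have [g _ gK] := f_bij; apply: inner_inj => z.
  by rewrite innerC -{1}(gK z) adjointP// aw0 inner0l innerC inner0l.
have a0 : 0 < `|adjoint f w| by rewrite normr_gt0.
rewrite -ler_pdivrMr// (le_trans _ (_ : M <= _))//; last first.
  by rewrite (le_trans (ler_norm _))// lerDl.
have -> : `|w| / `|adjoint f w| = `| `|adjoint f w|^-1 *: w|.
  by rewrite normrZ normfV normr_id mulrC.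
apply: HM => v; rewrite innerZr adjointP// normrM normfV normr_id.
by rewrite mulrC ler_pdivrMr// cauchy_schwarz.
Qed.

(** A bounded linear bijection is bounded below: [f f^*] is coercive, so [v] is
    [f^* w] where [f (f^* w) = f v] and [w] is bounded by [f v]. *)
Lemma bounded_inverse : exists2 K : R, 0 < K & forall v, `|v| <= K * `|f v|.
Proof.
have [K K0 fK] := bounded_operator_gt0 _ f_bounded.
have [Ka Ka0 aK] := bounded_operator_gt0 _ (adjoint_bounded _ f_bounded).
have [M M0 aM] := adjoint_bounded_below.
have coer w : (M ^+ 2)^-1 * `|w| ^+ 2 <= inner (f (adjoint f w)) w.
  rewrite adjointP// inner_norm mulrC ler_pdivrMr ?exprn_gt0// mulrC -exprMn.
  by rewrite ler_sqr ?nnegrE// mulr_ge0// ltW.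
exists (Ka * M ^+ 2) => [|v]; first by rewrite mulr_gt0// exprn_gt0.
have [|||||||w _ wE] := @variational_solution R W [set: W]
    (fun w => f (adjoint f w)) (K * Ka) (M ^+ 2)^-1
    (fun w => inner (f v) w) `|f v| linear_subspaceT closedT.
- by rewrite mulr_gt0.
- by move=> w; rewrite (le_trans (fK _))// -mulrA ler_wpM2l// ltW.
- by move=> w z; rewrite adjointP// innerC [RHS]innerC adjointP.
- by rewrite invr_gt0 exprn_gt0.
- exact: coer.
- by move=> a w z; rewrite innerDr innerZr.
- by move=> z; exact: cauchy_schwarz.
have fw : f (adjoint f w) = f v by apply: inner_inj => z; exact: wE.
rewrite -(bij_inj f_bij fw) (le_trans (aK _))// -mulrA ler_wpM2l ?(ltW Ka0)//.
have [->|w0] := eqVneq w 0; first by rewrite normr0 mulr_ge0// exprn_ge0// ltW.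
have := coer w; rewrite mulrC ler_pdivrMr ?exprn_gt0// fw => H.
rewrite -(@ler_pM2r _ `|w|) ?normr_gt0// -expr2 (le_trans H)// [leLHS]mulrC -[leRHS]mulrA.
rewrite ler_wpM2l ?exprn_ge0 ?(ltW M0)//.
exact: le_trans (ler_norm _) (cauchy_schwarz _ _).
Qed.

End BoundedInverse.

(** * The optimal control *)

Lemma op_invK {R : realType} {V W : hilbertType R} (f : V -> W) (w : W) :
  (exists v, f v = w) -> f (op_inv f w) = w.
Proof. exact: getPex. Qed.

Section Control.
Context {R : realType} {X Ystar Z : hilbertType R}.
Variables (Xad : set X) (B : {linear X -> Z}) (C : {linear X -> X}).
Variables (Istar : {linear Ystar -> Z}) (kappa : R).
Hypotheses (Xad_sub : linear_subspace Xad) (Xad_closed : closed Xad).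
Hypotheses (B_bounded : bounded_operator B) (C_bounded : bounded_operator C).
Hypothesis C_adj : forall u, C u = adjoint C u.
Hypotheses (kappa_gt0 : 0 < kappa)
  (C_coercive : forall u, kappa * `|u| ^+ 2 <= inner (C u) u).

Let C_sym u v : inner (C u) v = inner u (C v).
Proof. by rewrite adjointP// -C_adj. Qed.

Let C_solve (S : set X) (b : X) : linear_subspace S -> closed S ->
  exists2 w, S w & forall v, S v -> inner (C w) v = inner b v.
Proof.
move=> Ssub Scl; have [M M0 CM] := bounded_operator_gt0 _ C_bounded.
apply: (@variational_solution R X S C M kappa (inner b) `|b|) => //.
  by move=> a u v; rewrite innerDr innerZr.
by move=> v; exact: cauchy_schwarz.
Qed.

(** The control is the solution in [Xad] of a variational equation in which
    neither the inverse of [C] nor the projection occurs. *)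
Lemma controlP (lambda : R) (p : Ystar) : 0 < lambda ->
  let u := control Xad B C Istar lambda p in
  Xad u /\ forall v, Xad v -> lambda * inner (C u) v = inner (Istar p) (B v).
Proof.
move=> l0 u; set b := adjoint B (Istar p).
have CK : C (op_inv C b) = b.
  apply: op_invK; have [w _ wE] := C_solve _ b linear_subspaceT closedT.
  by exists w; apply: inner_inj => v; exact: wE.
have /getPex[] : exists w, Xad w /\ forall v, Xad v ->
    inner (C (lambda^-1 *: op_inv C b - w)) v = 0.
  have [w Sw wE] := C_solve _ (lambda^-1 *: b) Xad_sub Xad_closed.
  exists w; split => // v Sv; rewrite linearB linearZ/= CK innerBl wE//.
  by rewrite subrr.
rewrite -/(proj_wrt _ _ _) -/(control _ _ _ _ _ _) -/u => Su uE; split=> // v Sv.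
move/eqP: (uE v Sv); rewrite linearB linearZ/= CK innerBl subr_eq0 => /eqP <-.
by rewrite innerZl mulVKf ?gt_eqF// innerC -adjointP// innerC.
Qed.

End Control.

(** * Estimates for the least-squares functional *)

(** Young's inequality on both products; in the first one the weights are
    [lambda * kappa] and its inverse. *)
Lemma absorb_by_young {R : realFieldType} (lambda kappa k1 k2 u s rho eta : R) :
  0 < lambda -> 0 < kappa ->
  lambda * kappa * u ^+ 2 + s ^+ 2 <= k1 * (u * rho) + k2 * (s * eta) ->
  lambda * kappa * u ^+ 2 + s ^+ 2
    <= k1 ^+ 2 / kappa * (lambda^-1 * rho ^+ 2) + k2 ^+ 2 * eta ^+ 2.
Proof.
move=> l0 k0 H.
have : 0 <= (lambda * kappa * u - k1 * rho) ^+ 2 / (lambda * kappa).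
  by rewrite divr_ge0 ?sqr_ge0// mulr_ge0// ltW.
rewrite (_ : _ / _ = lambda * kappa * u ^+ 2 - 2 * (k1 * (u * rho))
  + k1 ^+ 2 / kappa * (lambda^-1 * rho ^+ 2)); last first.
  by field; rewrite !gt_eqF.
have := sqr_ge0 (s - k2 * eta).
rewrite (_ : (s - _) ^+ 2 = s ^+ 2 - 2 * (k2 * (s * eta)) + k2 ^+ 2 * eta ^+ 2);
  last by ring.
lra.
Qed.

Section LeastSquaresEstimates.
Context {R : realType} {H X Y Ystar Z : hilbertType R}.
Variables (Xad : set X) (A : {linear Z -> H}) (B : {linear X -> Z}).
Variables (C : {linear X -> X}) (L : {linear Y -> Z}).
Variables (Lstar : {linear Ystar -> Z}) (I : {linear Y -> Z}).
Variables (Istar : {linear Ystar -> Z}) (kappa : R).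
Hypotheses (Xad_sub : linear_subspace Xad) (Xad_closed : closed Xad).
Hypotheses (A_bounded : bounded_operator A) (B_bounded : bounded_operator B).
Hypothesis C_bounded : bounded_operator C.
Hypothesis C_adj : forall u, C u = adjoint C u.
Hypotheses (kappa_gt0 : 0 < kappa)
  (C_coercive : forall u, kappa * `|u| ^+ 2 <= inner (C u) u).
Hypotheses (L_bij : bijective L) (Lstar_bij : bijective Lstar).
Hypotheses (I_bounded : bounded_operator I)
  (Istar_bounded : bounded_operator Istar).
Hypothesis L_Istar : forall (y : Y) (p : Ystar),
  inner (L y) (Istar p) = inner (I y) (Lstar p).

Lemma state_ofP u : L (state_of B L u) = - B u.
Proof. by have [g _ gK] := L_bij; apply: op_invK; exists (g (- B u)). Qed.

Lemma adjoint_state_ofP y :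
  Lstar (adjoint_state_of A Lstar I y) = adjoint A (A (I y)).
Proof.
by have [g _ gK] := Lstar_bij; apply: op_invK; exists (g (adjoint A (A (I y)))).
Qed.

(** For zero data the residuals are the images of the two differences that
    occur in the energy. *)
Lemma ls_functional_homogeneous (alpha beta lambda : R) y p :
  ls_functional Xad A B C L Lstar I Istar alpha beta lambda y p 0 0 =
  alpha * `|L (y - state_of B L (control Xad B C Istar lambda p))| ^+ 2
  + beta * `|Lstar (p - adjoint_state_of A Lstar I y)| ^+ 2.
Proof.
by rewrite /ls_functional !subr0 !linearB state_ofP adjoint_state_ofP opprK.
Qed.

(** The optimality condition tested with the control itself: the term
    [|A I y_u|^2] appears with the favourable sign. *)
Lemma optimality_identity (lambda : R) y p : 0 < lambda ->
  let u := control Xad B C Istar lambda p in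
  let yu := state_of B L u in
  let q := p - adjoint_state_of A Lstar I y in
  lambda * inner (C u) u + `|A (I yu)| ^+ 2 =
  inner (Istar q) (B u) - inner (A (I yu)) (A (I (y - yu))).
Proof.
move=> l0 u yu q.
have [Su uE] := controlP _ _ _ Istar _ Xad_sub Xad_closed B_bounded C_bounded
  C_adj kappa_gt0 C_coercive lambda p l0.
rewrite (uE _ Su) -/u [Istar q]linearB innerBl.
have -> : inner (Istar (adjoint_state_of A Lstar I y)) (B u)
    = - inner (A (I yu)) (A (I y)).
  rewrite -[B u]opprK -state_ofP innerNr innerC L_Istar adjoint_state_ofP.
  by rewrite -adjointP.
by rewrite !linearB innerBr -inner_norm /=; ring.
Qed.

(** The control and observation terms of the energy are bounded, uniformly in
    [lambda], by its state and adjoint terms. *)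
Lemma control_energy_le : exists2 c : R, 0 < c &
  forall (lambda : R) (y : Y) (p : Ystar), 0 < lambda ->
  let u := control Xad B C Istar lambda p in
  let yu := state_of B L u in
  lambda * `|u| ^+ 2 + `|A (I yu)| ^+ 2 <=
  c * (`|y - yu| ^+ 2
       + lambda^-1 * `|p - adjoint_state_of A Lstar I y| ^+ 2).
Proof.
have [KA KA0 AK] := bounded_operator_gt0 _ A_bounded.
have [KB KB0 BK] := bounded_operator_gt0 _ B_bounded.
have [KI KI0 IK] := bounded_operator_gt0 _ I_bounded.
have [KJ KJ0 JK] := bounded_operator_gt0 _ Istar_bounded.
set k1 := KB * KJ; set k2 := KA * KI.
have k1_gt0 : 0 < k1 ^+ 2 / kappa by rewrite divr_gt0 ?exprn_gt0 ?mulr_gt0.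
have k2_gt0 : 0 < k2 ^+ 2 by rewrite exprn_gt0 ?mulr_gt0.
have ki_gt0 : 0 < kappa^-1 + 1 by rewrite addr_gt0 ?invr_gt0.
exists ((kappa^-1 + 1) * (k1 ^+ 2 / kappa + k2 ^+ 2)) => [|lambda y p l0].
  by rewrite mulr_gt0// addr_gt0.
move=> /=; set u := control _ _ _ _ _ _; set yu := state_of _ _ _.
set q := p - _; set e := y - yu.
have main : lambda * kappa * `|u| ^+ 2 + `|A (I yu)| ^+ 2 <=
    k1 * (`|u| * `|q|) + k2 * (`|A (I yu)| * `|e|).
  have idE := optimality_identity lambda y p l0.
  rewrite (@le_trans _ _ (lambda * inner (C u) u + `|A (I yu)| ^+ 2))//.
    by rewrite lerD2r -mulrA ler_wpM2l// ltW.
  rewrite [leLHS]idE -/u -/yu -/q -/e lerD//.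
    rewrite (le_trans (ler_norm _))// (le_trans (cauchy_schwarz _ _))//.
    rewrite (_ : k1 * _ = (KJ * `|q|) * (KB * `|u|)); last by rewrite /k1; ring.
    by rewrite ler_pM.
  rewrite (le_trans (ler_norm _))// normrN (le_trans (cauchy_schwarz _ _))//.
  rewrite mulrCA ler_wpM2l// (le_trans (AK _))// /k2 -mulrA ler_wpM2l//.
  exact: ltW.
have := @absorb_by_young _ _ _ _ _ _ _ _ _ l0 kappa_gt0 main.
set lu := lambda * _ * _; set s := `|A _| ^+ 2.
set x := lambda^-1 * _; set w := `|e| ^+ 2 => bound.
have x0 : 0 <= x by rewrite mulr_ge0 ?sqr_ge0// invr_ge0 ltW.
have w0 : 0 <= w by exact: sqr_ge0.
have s0 : 0 <= s by exact: sqr_ge0.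
have lu0 : 0 <= lu by rewrite !mulr_ge0// ltW.
have -> : lambda * `|u| ^+ 2 = kappa^-1 * lu.
  by rewrite /lu; field; exact: lt0r_neq0.
have ki0 : 0 <= kappa^-1 by rewrite invr_ge0 ltW.
rewrite (@le_trans _ _ ((kappa^-1 + 1) * (lu + s)))//.
  have := mulr_ge0 ki0 s0; lra.
rewrite -mulrA (ler_pM2l ki_gt0) (le_trans bound)//.
have := mulr_ge0 (ltW k1_gt0) w0; have := mulr_ge0 (ltW k2_gt0) x0; lra.
Qed.

End LeastSquaresEstimates.

Theorem theorem12 (R : realType) (H X Y Ystar Z : hilbertType R)
    (n : nat) (d m : 'I_n -> nat)
    (Omega : forall j : 'I_n, set 'rV[R]_(d j).+1)
    (Xad : set X)
    (A : {linear Z -> H}) (B : {linear X -> Z}) (C : {linear X -> X})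
    (L : {linear Y -> Z}) (Lstar : {linear Ystar -> Z})
    (I : {linear Y -> Z}) (Istar : {linear Ystar -> Z})
    (kappa : R)
    (hn : (0 < n)%N)
    (hOmega : forall j : 'I_n, lipschitz_domain (Omega j))
    (hZ : is_L2_product m Omega Z)
    (hXad : linear_subspace Xad) (hXad_closed : closed Xad)
    (hA : bounded_operator A) (hB : bounded_operator B)
    (hC : bounded_operator C)
    (hC_adj : forall u : X, C u = adjoint C u)
    (hkappa : 0 < kappa)
    (hC_coercive : forall u : X, kappa * `|u| ^+ 2 <= inner (C u) u)
    (hL : bounded_operator L) (hL_bij : bijective L)
    (hLstar : bounded_operator Lstar) (hLstar_bij : bijective Lstar)
    (hI : bounded_operator I) (hIstar : bounded_operator Istar)
    (hLI : forall (y : Y) (p : Ystar),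
      inner (L y) (Istar p) = inner (I y) (Lstar p))
    (a0 a1 b0 b1 : R)
    (ha0 : 0 < a0) (ha1 : 0 < a1) (hb0 : 0 < b0) (hb1 : 0 < b1) :
  exists c0 c1 : R, [/\ 0 < c0, 0 < c1 &
    forall lambda alpha beta : R,
      0 < lambda <= 1 ->
      0 < alpha -> 0 < beta ->
      a0 <= alpha <= a1 ->
      b0 * lambda^-1 <= beta <= b1 * lambda^-1 ->
      forall (y : Y) (p : Ystar),
        reduced_energy_sq Xad A B C L Lstar I Istar lambda y p
          <= c0 * ls_functional Xad A B C L Lstar I Istar
                    alpha beta lambda y p 0 0
        /\ ls_functional Xad A B C L Lstar I Istar alpha beta lambda y p 0 0
          <= c1 * reduced_energy_sq Xad A B C L Lstar I Istar lambda y p].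
Proof.
have [c c0 cP] := control_energy_le _ A B C L Lstar I Istar _ hXad hXad_closed
  hA hB hC hC_adj hkappa hC_coercive hL_bij hLstar_bij hI hIstar hLI.
have [KL KL0 LK] := bounded_operator_gt0 _ hL.
have [KM KM0 MK] := bounded_operator_gt0 _ hLstar.
have [JL JL0 LJ] := bounded_inverse _ hL hL_bij.
have [JM JM0 MJ] := bounded_inverse _ hLstar hLstar_bij.
have sq0 (a : R) : 0 < a -> 0 < a ^+ 2 by move=> ?; rewrite exprn_gt0.
have sqM (a b k : R) : 0 <= a -> 0 < k -> a <= k * b -> a ^+ 2 <= k ^+ 2 * b ^+ 2.
  move=> a_ge0 k0 ab; rewrite -exprMn ler_sqr ?nnegrE//.
  exact: le_trans a_ge0 ab.
exists ((c + 1) * (JL ^+ 2 / a0 + JM ^+ 2 / b0)).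
exists (a1 * KL ^+ 2 + b1 * KM ^+ 2).
split=> [||lambda alpha beta /andP[l0 l1] al0 be0 /andP[aal ala]
    /andP[bbe beb] y p].
- by rewrite mulr_gt0// ?addr_gt0// divr_gt0// sq0.
- by rewrite addr_gt0// mulr_gt0// sq0.
rewrite ls_functional_homogeneous// /reduced_energy_sq /energy_sq.
have := cP lambda y p l0.
set u := control _ _ _ _ _ _; set e := y - _; set q := p - _ => /= key.
set E1 := `|e| ^+ 2 in key *; set E2 := lambda^-1 * `|q| ^+ 2 in key *.
set G1 := alpha * _; set G2 := beta * _.
have li : 0 < lambda^-1 by rewrite invr_gt0.
have [E10 E20] : 0 <= E1 /\ 0 <= E2.
  by split; rewrite ?sqr_ge0// mulr_ge0 ?sqr_ge0// ltW.
have [G10 G20] : 0 <= G1 /\ 0 <= G2.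
  by split; rewrite mulr_ge0 ?sqr_ge0// ltW.
have Ele1 : E1 <= JL ^+ 2 / a0 * G1.
  apply: (le_trans (sqM _ _ _ _ _ (LJ e))) => //.
  by rewrite -mulrA ler_pM2l ?sq0// ler_pdivlMl// ler_wpM2r.
have Ele2 : E2 <= JM ^+ 2 / b0 * G2.
  apply: (@le_trans _ _ (lambda^-1 * (JM ^+ 2 * `|Lstar q| ^+ 2))).
    by rewrite ler_pM2l// sqM.
  by rewrite mulrCA -mulrA ler_pM2l ?sq0// ler_pdivlMl// mulrA ler_wpM2r.
have Gle1 : G1 <= a1 * KL ^+ 2 * E1.
  by rewrite -mulrA ler_pM ?sqr_ge0 ?(ltW al0)// sqM.
have Gle2 : G2 <= b1 * KM ^+ 2 * E2.
  rewrite (_ : _ * E2 = (b1 * lambda^-1) * (KM ^+ 2 * `|q| ^+ 2)).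
    by rewrite ler_pM ?sqr_ge0 ?(ltW be0)// sqM.
  by rewrite /E2; ring.
(* the products of each constant with the other term, for the linear
   arithmetic below *)
have cross1 := mulr_ge0 (ltW (divr_gt0 (sq0 _ JL0) ha0)) G20.
have cross2 := mulr_ge0 (ltW (divr_gt0 (sq0 _ JM0) hb0)) G10.
have cross3 := mulr_ge0 (ltW (mulr_gt0 ha1 (sq0 _ KL0))) E20.
have cross4 := mulr_ge0 (ltW (mulr_gt0 hb1 (sq0 _ KM0))) E10.
have c1 : 0 < c + 1 by rewrite addr_gt0.
split.
  apply: (@le_trans _ _ ((c + 1) * (E1 + E2))); first lra.
  by rewrite -mulrA ler_pM2l//; lra.
have : 0 <= lambda * `|u| ^+ 2 by rewrite mulr_ge0 ?sqr_ge0// ltW.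
have := sqr_ge0 `|A (I (state_of B L u))|.
set s := `|A _| ^+ 2; set lu := lambda * _ => lu0 s0.
apply: (@le_trans _ _ ((a1 * KL ^+ 2 + b1 * KM ^+ 2) * (E1 + E2))); first lra.
rewrite ler_pM2l ?addr_gt0 ?mulr_gt0 ?sq0//; lra.
Qed.
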